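(* Let $\overline{A_0A_1A_2A_3}$ be a tetrahedron in $\mathbb{A}^3$ that is $B$-tri-rectangular at $A_0$, with all four $B$-quadreas $\mathcal{A}_{012},\mathcal{A}_{013},\mathcal{A}_{023},\mathcal{A}_{123}$ nonzero. Then its $B$-dual solid spreads satisfy $$\mathcal{D}_1+\mathcal{D}_2+\mathcal{D}_3=1.$$
   Context: Let $\mathbb{F}$ be a field of characteristic not $2$, $\mathbb{V}^3=\mathbb{F}^3$ the space of row vectors, and $\mathbb{A}^3$ the three-dimensional affine space over $\mathbb{F}$ with associated vector space $\mathbb{V}^3$; $\overrightarrow{XY}=Y-X$ for points $X,Y$. Let $B$ be a symmetric invertible $3\times3$ matrix over $\mathbb{F}$. Define $v\cdot_B w=vBw^T$, $Q_B(v)=v\cdot_B v$, $v\times_B w=(v\times w)\,\mathrm{adj}\,B$ where $\times$ is the usual cross product and $\mathrm{adj}\,B=(\det B)B^{-1}$, and $[v_1,v_2,v_3]_B=v_1\cdot_B(v_2\times_B v_3)$. A tetrahedron $\overline{A_0A_1A_2A_3}$ is a collection of four points of $\mathbb{A}^3$. Put $Q_{ij}=Q_B(\overrightarrow{A_iA_j})$ (symmetric in $i,j$). The $B$-quadreas are $\mathcal{A}_{ijk}=A(Q_{ij},Q_{ik},Q_{jk})$ with $A(a,b,c)=(a+b+c)^2-2(a^2+b^2+c^2)$. The tetrahedron is $B$-tri-rectangular at $A_0$ if the vectors $v_i=\overrightarrow{A_0A_i}$ ($i=1,2,3$) are mutually $B$-perpendicular: $v_1\cdot_B v_2=v_1\cdot_B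 v_3=v_2\cdot_B v_3=0$. The $B$-solid spread of three concurrent lines with non-null direction vectors $u_1,u_2,u_3$ (that is, $Q_B(u_i)\neq 0$) is $\frac{([u_1,u_2,u_3]_B)^2}{(\det B)Q_B(u_1)Q_B(u_2)Q_B(u_3)}$. The $B$-dual solid spread of three concurrent lines with direction vectors $w_1,w_2,w_3$ is the $B$-solid spread of the three lines through the same point with direction vectors $w_1\times_B w_2$, $w_1\times_B w_3$, $w_2\times_B w_3$ (assumed non-null). For $\{i,j,k,l\}=\{0,1,2,3\}$, $\mathcal{D}_i$ is the $B$-dual solid spread of the lines $A_iA_j$, $A_iA_k$, $A_iA_l$. When all four $B$-quadreas are nonzero, all $\mathcal{D}_i$ are defined. *)

(* Defs.v *)
From HB Require Import structures.
From mathcomp Require Import all_boot all_order all_algebra.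

Set Implicit Arguments.
Unset Strict Implicit.
Unset Printing Implicit Defensive.

Import GRing.Theory.
Local Open Scope ring_scope.

(* Points of the affine space and vectors are both elements of 'rV[F]_3; the
   vector from X to Y is Y - X. *)

Section BGeometry.

Variables (F : fieldType) (B : 'M[F]_3).
Implicit Types (u v w : 'rV[F]_3) (X Y Z T : 'rV[F]_3).

Definition bdot v w : F := (v *m B *m w^T) 0 0.

Definition bquad v : F := bdot v v.

(* Indices are added modulo 3, so this is the usual cross product
   (u1 v2 - u2 v1, u2 v0 - u0 v2, u0 v1 - u1 v0). *)
Definition cross u v : 'rV[F]_3 :=
  \row_(i < 3) (u 0 (i + 1) * v 0 (i + 2%:R) - u 0 (i + 2%:R) * v 0 (i + 1)).

(* For invertible B, the matrix \det B *: invmx B is the adjugate \adj B. *)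
Definition bcross v w : 'rV[F]_3 := cross v w *m (\det B *: invmx B).

Definition btriple u v w : F := bdot u (bcross v w).

Definition bquadrance X Y : F := bquad (Y - X).

Definition archimedes (a b c : F) : F :=
  (a + b + c) ^+ 2 - 2%:R * (a ^+ 2 + b ^+ 2 + c ^+ 2).

Definition bquadrea X Y Z : F :=
  archimedes (bquadrance X Y) (bquadrance X Z) (bquadrance Y Z).

Definition btri_rectangular X Y Z T : Prop :=
  [/\ bdot (Y - X) (Z - X) = 0,
      bdot (Y - X) (T - X) = 0 &
      bdot (Z - X) (T - X) = 0].

(* A line is given by a direction vector: rescaling any of u, v, w by a nonzero
   scalar, or permuting them, does not change the value. It is meaningful only
   when u, v and w are non-null. *)
Definition bsolid_spread u v w : F :=
  btriple u v w ^+ 2 / (\det B * bquad u * bquad v * bquad w).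

Definition bdual_solid_spread u v w : F :=
  bsolid_spread (bcross u v) (bcross u w) (bcross v w).

(* The dual solid spread at X of the lines XY, XZ, XT. For symmetric B,
   4 * bquad (bcross (Y - X) (Z - X)) = \det B * bquadrea X Y Z, so nonzero
   quadreas (and characteristic not 2, B invertible) make the three derived
   directions non-null. *)
Definition bdual_solid_spread_at X Y Z T : F :=
  bdual_solid_spread (Y - X) (Z - X) (T - X).

End BGeometry.

(* Main.v *)
Require Import Defs.
From HB Require Import structures.
From mathcomp Require Import all_boot all_order all_algebra.
From mathcomp Require Import ring.

(** The dual solid spread of three lines depends only on the Gram matrix of
    their directions: writing [G] for the determinant of the [B]-Gram matrix of
    [u], [v], [w], and [m] for its three principal 2x2 minors,
    [D = G ^ 2 / (m_uv * m_uw * m_vw)] ([bdual_solid_spread_gram]).  Two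
    identities give this.  The square of a [B]-triple product is [\det B] times
    a Gram determinant ([btriple_sqr]), and the [B]-dot product of two
    [B]-cross products is [\det B] times a 2x2 Gram minor
    ([bdot_bcross], the Binet-Cauchy identity for [B]).  Hence the Gram matrix
    of the three [B]-cross products is, up to [\det B], the second compound of
    the Gram matrix of [u], [v], [w], whose determinant is [G ^ 2]; all the
    powers of [\det B] cancel.

    At a vertex other than the right-angled one everything is now explicit.  Let
    [a], [b], [c] be the quadrances of the three mutually perpendicular edges.
    Seen from any vertex, the edge vectors have Gram determinant [a * b * c];
    at the end of the first edge the minors are [a * b], [a * c] and
    [a * b + a * c + b * c], the last being that of the face opposite the right
    angle.  So [D_1 = b * c / (a * b + a * c + b * c)]
    ([bdual_solid_spread_perp]), and the three such fractions sum to one.  The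
    quadreas are [4 * a * b], [4 * a * c], [4 * b * c] and
    [4 * (a * b + a * c + b * c)], so their being nonzero justifies the
    divisions. *)

Set Implicit Arguments.
Unset Strict Implicit.
Unset Printing Implicit Defensive.

Import GRing.Theory.
Local Open Scope ring_scope.

Lemma det_mx33 (R : comNzRingType) (A : 'M[R]_3) :
  \det A = A 0 0 * (A 1 1 * A 2%:R 2%:R - A 1 2%:R * A 2%:R 1)
         - A 0 1 * (A 1 0 * A 2%:R 2%:R - A 1 2%:R * A 2%:R 0)
         + A 0 2%:R * (A 1 0 * A 2%:R 1 - A 1 1 * A 2%:R 0).
Proof.
pose a (i j : nat) := A (inord i) (inord j).
have aE (i j : 'I_3) : A i j = a i j by rewrite /a !inord_val.
rewrite (expand_det_row _ 0) !big_ord_recl big_ord0 /cofactor.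
rewrite !(expand_det_row _ 0) !big_ord_recl !big_ord0 /cofactor !det_mx11.
rewrite !mxE !aE /=; ring.
Qed.

Lemma sum_ord3 (V : nmodType) (f : 'I_3 -> V) :
  \sum_i f i = f 0 + f 1 + f 2%:R.
Proof.
rewrite !big_ord_recl big_ord0 addr0 addrA.
by congr (_ + f _ + f _); apply/val_inj.
Qed.

Lemma ord3D :
  ((0 + 1 = 1 :> 'I_3)%R * (0 + 2%:R = 2%:R :> 'I_3)%R *
   (1 + 1 = 2%:R :> 'I_3)%R * (1 + 2%:R = 0 :> 'I_3)%R *
   (2%:R + 1 = 0 :> 'I_3)%R * (2%:R + 2%:R = 1 :> 'I_3)%R)%type.
Proof. by do !split; apply/val_inj. Qed.

Section BIdentities.

Variables (F : fieldType) (B : 'M[F]_3).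
Implicit Types (u v w p q : 'rV[F]_3) (M : 'M[F]_3).

Definition rows3 u v w : 'M[F]_3 :=
  \matrix_(i < 3) (if i == 0 then u else if i == 1 then v else w).

Lemma rows3_mul u v w M : rows3 u v w *m M = rows3 (u *m M) (v *m M) (w *m M).
Proof.
apply/row_matrixP => i; rewrite row_mul !rowK.
by case: ifP => _ //; case: ifP.
Qed.

(** The scalar triple product; stated as a determinant, it transforms under a
    linear map by multiplicativity of [\det]. *)
Lemma mulmx_cross u v w : (u *m (cross v w)^T) 0 0 = \det (rows3 u v w).
Proof.
by rewrite det_mx33 mxE sum_ord3 !mxE /= !ord3D; ring.
Qed.

Lemma dot_cross u v p q :
  (cross u v *m (cross p q)^T) 0 0 =
  (u *m p^T) 0 0 * (v *m q^T) 0 0 - (u *m q^T) 0 0 * (v *m p^T) 0 0.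
Proof.
by rewrite !mxE !sum_ord3 !mxE !ord3D; ring.
Qed.

Lemma bdotBl u v w : bdot B (u - v) w = bdot B u w - bdot B v w.
Proof. by rewrite /bdot !mulmxBl !mxE. Qed.

Lemma bdotBr u v w : bdot B u (v - w) = bdot B u v - bdot B u w.
Proof. by rewrite /bdot linearB mulmxBr !mxE. Qed.

Lemma bdotNl u v : bdot B (- u) v = - bdot B u v.
Proof. by rewrite /bdot !mulNmx !mxE. Qed.

Lemma bdotNr u v : bdot B u (- v) = - bdot B u v.
Proof. by rewrite /bdot linearN mulmxN !mxE. Qed.

Definition bdotE := (bdotBl, bdotBr, bdotNl, bdotNr).

Definition bgram u v w : F := \det (rows3 u v w *m B *m (rows3 u v w)^T).

Definition bminor u v : F := bquad B u * bquad B v - bdot B u v ^+ 2.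

Hypothesis symB : B^T = B.

Lemma bdotC u v : bdot B u v = bdot B v u.
Proof.
by rewrite /bdot -[u *m B *m v^T]trmxK mxE !trmx_mul trmxK symB mulmxA.
Qed.

Lemma bgramE u v w :
  bgram u v w =
    bquad B u * bquad B v * bquad B w
    + 2%:R * (bdot B u v * bdot B u w * bdot B v w)
    - bquad B u * bdot B v w ^+ 2 - bquad B v * bdot B u w ^+ 2
    - bquad B w * bdot B u v ^+ 2.
Proof.
set r := fun i : 'I_3 => if i == 0 then u else if i == 1 then v else w.
have gE i j : (rows3 u v w *m B *m (rows3 u v w)^T) i j = bdot B (r i) (r j).
  have -> : bdot B (r i) (r j)
      = (row i (rows3 u v w) *m B *m (row j (rows3 u v w))^T) 0 0.
    by rewrite !rowK.
  by rewrite -row_mul !mxE; apply: eq_bigr => k _; rewrite !mxE.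
rewrite /bgram det_mx33 !gE /r /= /bquad.
rewrite (bdotC v u) (bdotC w u) (bdotC w v); ring.
Qed.

Hypothesis unitB : B \in unitmx.

Let detB0 : \det B != 0. Proof. by rewrite -unitfE -unitmxE. Qed.

Let trinvB : (\det B *: invmx B)^T = \det B *: invmx B.
Proof. by rewrite linearZ /= trmx_inv symB. Qed.

(** Both sides have the same pairing with every [u *m B], because
    [rows3 u v w *m B] has determinant [\det (rows3 u v w) * \det B]; and the
    vectors [u *m B] fill the whole space. *)
Lemma bcross_mul v w : bcross B v w = cross (v *m B) (w *m B).
Proof.
suff eqB : B *m (cross (v *m B) (w *m B))^T = \det B *: (cross v w)^T.
  apply: trmx_inj; rewrite -[RHS](mulKmx unitB) eqB /bcross trmx_mul trinvB.
  by rewrite -scalemxAl -scalemxAr.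
apply/row_matrixP => i; apply/rowP => j; rewrite ord1 !rowE mulmxA.
rewrite mulmx_cross -rows3_mul det_mulmx -mulmx_cross -scalemxAr [RHS]mxE.
exact: mulrC.
Qed.

Lemma bdot_bcrossr x v w :
  bdot B x (bcross B v w) = \det B * (x *m (cross v w)^T) 0 0.
Proof.
rewrite /bdot /bcross trmx_mul trinvB -scalemxAl -scalemxAr mxE.
by rewrite mulmxA mulmxK.
Qed.

Lemma bdot_bcross u v p q :
  bdot B (bcross B u v) (bcross B p q) =
  \det B * (bdot B u p * bdot B v q - bdot B u q * bdot B v p).
Proof. by rewrite bdot_bcrossr bcross_mul dot_cross. Qed.

Lemma bquad_bcross u v : bquad B (bcross B u v) = \det B * bminor u v.
Proof. by rewrite /bquad bdot_bcross (bdotC v u). Qed.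

Lemma btriple_sqr u v w : btriple B u v w ^+ 2 = \det B * bgram u v w.
Proof.
rewrite /btriple bdot_bcrossr mulmx_cross /bgram !det_mulmx det_tr; ring.
Qed.

(** By [bdot_bcross] the Gram matrix of the three cross products is [\det B]
    times the second compound of the Gram matrix of [u], [v], [w], and the
    second compound of a 3x3 matrix has the square of its determinant. *)
Lemma bgram_bcross u v w :
  bgram (bcross B u v) (bcross B u w) (bcross B v w) =
  \det B ^+ 3 * bgram u v w ^+ 2.
Proof.
rewrite !bgramE !bquad_bcross !bdot_bcross /bminor /bquad.
rewrite (bdotC v u) (bdotC w v); ring.
Qed.

(** Numerator and denominator of the solid spread both carry the factor
    [\det B ^+ 4]; what remains is a ratio of Gram minors.  Where one of the
    2x2 minors vanishes, both sides are zero because [0^-1 = 0]. *)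
Lemma bdual_solid_spread_gram u v w :
  bdual_solid_spread B u v w =
  bgram u v w ^+ 2 / (bminor u v * bminor u w * bminor v w).
Proof.
rewrite /bdual_solid_spread /bsolid_spread btriple_sqr bgram_bcross.
rewrite !bquad_bcross.
set m := bminor u v; set n := bminor u w; set k := bminor v w.
have -> : \det B * (\det B * m) * (\det B * n) * (\det B * k)
    = \det B ^+ 4 * (m * n * k) by ring.
rewrite mulrA -exprS -mulf_div divff ?mul1r //.
by rewrite expf_neq0.
Qed.

Section Perpendicular.

Variables u v w : 'rV[F]_3.
Hypotheses (uv0 : bdot B u v = 0) (uw0 : bdot B u w = 0).

Lemma archimedes_perp :
  archimedes (bquad B u) (bquad B v) (bquad B (v - u)) =
  4%:R * (bquad B u * bquad B v).
Proof.
rewrite /archimedes /bquad !bdotE (bdotC v u) uv0; ring.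
Qed.

Hypothesis vw0 : bdot B v w = 0.

Definition bquad_sym2 : F :=
  bquad B u * bquad B v + bquad B u * bquad B w + bquad B v * bquad B w.

Lemma archimedes_opposite :
  archimedes (bquad B (v - u)) (bquad B (w - u)) (bquad B (w - v)) =
  4%:R * bquad_sym2.
Proof.
rewrite /archimedes /bquad_sym2 /bquad !bdotE.
rewrite (bdotC v u) (bdotC w u) (bdotC w v) uv0 uw0 vw0; ring.
Qed.

(** The vectors [- u], [v - u], [w - u] point from the end of the edge [u] to
    the other vertices, the right-angled one first. *)
Lemma bdual_solid_spread_perp :
  bquad B u != 0 -> bquad B v != 0 -> bquad B w != 0 -> bquad_sym2 != 0 ->
  bdual_solid_spread B (- u) (v - u) (w - u) =
  bquad B v * bquad B w / bquad_sym2.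
Proof.
move=> a0 b0 c0 s0; rewrite bdual_solid_spread_gram.
have -> : bgram (- u) (v - u) (w - u) = bquad B u * bquad B v * bquad B w.
  rewrite bgramE /bquad !bdotE.
  rewrite (bdotC v u) (bdotC w u) uv0 uw0 vw0; ring.
have -> : bminor (- u) (v - u) = bquad B u * bquad B v.
  rewrite /bminor /bquad !bdotE (bdotC v u) uv0; ring.
have -> : bminor (- u) (w - u) = bquad B u * bquad B w.
  rewrite /bminor /bquad !bdotE (bdotC w u) uw0; ring.
have -> : bminor (v - u) (w - u) = bquad_sym2.
  rewrite /bminor /bquad_sym2 /bquad !bdotE.
  rewrite (bdotC v u) (bdotC w u) uv0 uw0 vw0; ring.
by field; rewrite a0 b0 c0 s0.
Qed.

End Perpendicular.

End BIdentities.

Theorem theorem28 (F : fieldType) (charF : 2%N \notin [pchar F])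
    (B : 'M[F]_3) (symB : B^T = B) (unitB : B \in unitmx)
    (A0 A1 A2 A3 : 'rV[F]_3)
    (triA : btri_rectangular B A0 A1 A2 A3)
    (nz012 : bquadrea B A0 A1 A2 != 0)
    (nz013 : bquadrea B A0 A1 A3 != 0)
    (nz023 : bquadrea B A0 A2 A3 != 0)
    (nz123 : bquadrea B A1 A2 A3 != 0) :
  bdual_solid_spread_at B A1 A0 A2 A3 +
  bdual_solid_spread_at B A2 A0 A1 A3 +
  bdual_solid_spread_at B A3 A0 A1 A2 = 1.
Proof.
pose v1 := A1 - A0; pose v2 := A2 - A0; pose v3 := A3 - A0.
have edge X Y : X - Y = (X - A0) - (Y - A0) by rewrite opprB addrA subrK.
have [d12 d13 d23] : [/\ bdot B v1 v2 = 0, bdot B v1 v3 = 0 & bdot B v2 v3 = 0]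
  by [].
have [d21 d31 d32] : [/\ bdot B v2 v1 = 0, bdot B v3 v1 = 0 & bdot B v3 v2 = 0]
  by rewrite (bdotC symB v2) !(bdotC symB v3).
move: nz012 nz013 nz123; rewrite /bquadrea /bquadrance.
rewrite (edge A2 A1) (edge A3 A1) (edge A3 A2) -/v1 -/v2 -/v3.
rewrite !archimedes_perp // archimedes_opposite // !mulf_eq0 !negb_or.
move=> /and3P[_ a0 b0] /and3P[_ _ c0] /andP[_ s0].
have s213 : bquad_sym2 B v2 v1 v3 = bquad_sym2 B v1 v2 v3.
  by rewrite /bquad_sym2; ring.
have s312 : bquad_sym2 B v3 v1 v2 = bquad_sym2 B v1 v2 v3.
  by rewrite /bquad_sym2; ring.
(* At [A_i] the edge back to [A0] is [- v_i], the others [v_j - v_i]. *)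
rewrite /bdual_solid_spread_at.
rewrite -(opprB A1) -(opprB A2) -(opprB A3 A0).
rewrite (edge A2 A1) (edge A3 A1) (edge A1 A2) (edge A3 A2) (edge A1 A3).
rewrite (edge A2 A3) -/v1 -/v2 -/v3.
rewrite !bdual_solid_spread_perp ?s213 ?s312 //.
rewrite -!mulrDl -[RHS](divff s0); congr (_ / _); rewrite /bquad_sym2; ring.
Qed.
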